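(* Let $p$ be a prime, and let $s(n)_{n\geq 0}$ be a sequence of $p$-adic integers satisfying a linear recurrence $s(n+\ell)+a_{\ell-1}s(n+\ell-1)+\cdots+a_1 s(n+1)+a_0 s(n)=0$ for all $n\ge 0$, with constant coefficients $a_i\in\mathbb{Z}_p$ (so its characteristic polynomial $g(x)=x^\ell+a_{\ell-1}x^{\ell-1}+\cdots+a_0\in\mathbb{Z}_p[x]$ is monic). Then there exists an analytic approximate twisted interpolation of $s(n)_{n\geq 0}$ to $\mathbb{Z}_p$.
   Context: $\mathbb N=\{0,1,2,\dots\}$. Let $p$ be a prime, $q\ge1$ a power of $p$, and $s(n)_{n\ge0}$ a sequence of $p$-adic integers. Suppose $\mathbb N=\bigcup_{j\in J}A_j$ is a finite partition of $\mathbb N$ such that each $A_j$ is dense in $r_j+q\mathbb{Z}_p$ for some $0\le r_j\le q-1$; let $K$ be a finite extension of $\mathbb{Q}_p$ with its unique absolute value $|\cdot|_p$ extending that of $\mathbb{Q}_p$, and for each $j$ let $s_j:\mathbb{Z}_p\to K$ be continuous. The family $\{(s_j,A_j):j\in J\}$ is an approximate twisted interpolation of $s(n)_{n\ge 0}$ to $\mathbb{Z}_p$ if there are constants $C\ge 0$ and $0\le D<1$ with $|s(n)-s_j(n)|_p\le CD^n$ for all $n\in A_j$ and all $j\in J$. It is analytic if for each $j$ the function $x\mapsto s_j(qx+r_j)$, $x\in\mathbb{Z}_p$, is given by a power series in $x$ with coefficients in $K$ converging on all of $\mathbb{Z}_p$. *)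

(* Defs.v *)
From HB Require Import structures.
From mathcomp Require Import all_boot all_order all_algebra.
From mathcomp Require Import reals.
Set Implicit Arguments. Unset Strict Implicit. Unset Printing Implicit Defensive.
Import Order.TTheory GRing.Theory Num.Theory.

(* p-adic integers as the inverse limit of Z/p^k Z: an element x is a   *)
(* sequence of residues x k (reduced mod p^k) that are compatible:      *)
(*   x k.+1 = x k (mod p^k).                                            *)
Definition zp_cond (p : nat) (x : nat -> nat) : Prop :=
  forall k, x k %% p ^ k = x k /\ x k.+1 %% p ^ k = x k.

Record PadicInt (p : nat) := MkZp { zpv : nat -> nat; zpP : zp_cond p zpv }.

Lemma zp_mk_ok (p : nat) (y : nat -> nat)
  (hy : forall k, y k.+1 = y k %[mod p ^ k]) :
  zp_cond p (fun k => y k %% p ^ k)%N.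
Proof.
move=> k; split; first by rewrite modn_mod.
by rewrite modn_dvdm ?hy // dvdn_exp2l.
Qed.

Definition zp_mk (p : nat) (y : nat -> nat)
  (hy : forall k, y k.+1 = y k %[mod p ^ k]) : PadicInt p :=
  @MkZp p _ (zp_mk_ok hy).

Definition zp_of_nat (p n : nat) : PadicInt p :=
  @zp_mk p (fun _ => n) (fun _ => erefl).

Lemma zp_add_ok (p : nat) (x y : PadicInt p) (k : nat) :
  zpv x k.+1 + zpv y k.+1 = zpv x k + zpv y k %[mod p ^ k].
Proof. by rewrite -modnDm (proj2 (zpP x k)) (proj2 (zpP y k)). Qed.

Lemma zp_mul_ok (p : nat) (x y : PadicInt p) (k : nat) :
  zpv x k.+1 * zpv y k.+1 = zpv x k * zpv y k %[mod p ^ k].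
Proof. by rewrite -modnMm (proj2 (zpP x k)) (proj2 (zpP y k)). Qed.

Definition zp_add (p : nat) (x y : PadicInt p) : PadicInt p := zp_mk (zp_add_ok x y).
Definition zp_mul (p : nat) (x y : PadicInt p) : PadicInt p := zp_mk (zp_mul_ok x y).

Definition zp_affine (p q r : nat) (x : PadicInt p) : PadicInt p :=
  zp_add (zp_mul (zp_of_nat p q) x) (zp_of_nat p r).

Definition in_coset (p q r : nat) (x : PadicInt p) : Prop :=
  exists y : PadicInt p, zpv x =1 zpv (zp_affine q r y).

Definition dense_in_coset (p q r : nat) (A : pred nat) : Prop :=
  (forall n, A n -> in_coset q r (zp_of_nat p n)) /\
  (forall x : PadicInt p, in_coset q r x ->
     forall k, exists n, A n /\ n %% p ^ k = zpv x k).

Local Open Scope ring_scope.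

Definition is_absval (K : fieldType) (R : realType) (absK : K -> R) : Prop :=
  [/\ forall x, 0 <= absK x,
      forall x, absK x = 0 <-> x = 0,
      forall x y, absK (x * y) = absK x * absK y &
      forall x y, absK (x + y) <= absK x + absK y].

(* K is a finite extension of Q_p (Q_p = Z_p[1/p] embedded by iota) and
   absK is an absolute value on K extending |.|_p, where
   |a|_p = p^-k when a = 0 mod p^k and a <> 0 mod p^(k+1). *)
Definition finite_ext_Qp (p : nat) (K : fieldType) (R : realType)
  (iota : PadicInt p -> K) (absK : K -> R) : Prop :=
  [/\
      [/\ iota (zp_of_nat p 1) = 1,
        forall x y, iota (zp_add x y) = iota x + iota y &
        forall x y, iota (zp_mul x y) = iota x * iota y],
      is_absval absK,
      (forall (a : PadicInt p) k, zpv a k = 0 -> zpv a k.+1 != 0 ->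
          absK (iota a) = ((p%:R : R) ^+ k)^-1) &
      (* K is finite dimensional over Q_p = iota(Z_p)[1/p] *)
      exists (d : nat) (e : 'I_d -> K), forall y : K,
        exists (c : 'I_d -> PadicInt p) (k : nat),
          (p%:R : K) ^+ k * y = \sum_(i < d) iota (c i) * e i].

Definition zp_continuous (p : nat) (K : fieldType) (R : realType)
  (absK : K -> R) (f : PadicInt p -> K) : Prop :=
  forall (x : PadicInt p) (eps : R), 0 < eps ->
    exists k, forall y : PadicInt p, zpv y k = zpv x k -> absK (f y - f x) < eps.

Definition pseries_to (K : fieldType) (R : realType) (absK : K -> R)
  (c : nat -> K) (z L : K) : Prop :=
  forall eps : R, 0 < eps -> exists N, forall M, (N <= M)%N ->
    absK (\sum_(m < M) c m * z ^+ m - L) < eps.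

Definition approx_twisted_interp (p : nat) (K : fieldType) (R : realType)
  (iota : PadicInt p -> K) (absK : K -> R) (s : nat -> PadicInt p)
  (q : nat) (J : finType) (A : J -> pred nat) (r : J -> nat)
  (sj : J -> PadicInt p -> K) : Prop :=
  [/\ (1 <= q)%N /\ (exists e, q = p ^ e)%N,
      (forall n, exists! j, A j n),
      (forall j, (r j < q)%N /\ dense_in_coset p q (r j) (A j)),
      (forall j, zp_continuous absK (sj j)) &
      exists C D : R, [/\ 0 <= C, 0 <= D, D < 1 &
        forall j n, A j n ->
          absK (iota (s n) - sj j (zp_of_nat p n)) <= C * D ^+ n]].

Definition interp_analytic (p : nat) (K : fieldType) (R : realType)
  (iota : PadicInt p -> K) (absK : K -> R)
  (q : nat) (J : finType) (r : J -> nat) (sj : J -> PadicInt p -> K) : Prop :=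
  forall j, exists c : nat -> K, forall x : PadicInt p,
    pseries_to absK c (iota x) (sj j (zp_affine q (r j) x)).

(* Main.v *)
Require Import Defs.
From HB Require Import structures.
From mathcomp Require Import all_boot all_order all_algebra.
From mathcomp Require Import boolp reals.
From mathcomp Require Import zify ring lra.
Set Implicit Arguments. Unset Strict Implicit. Unset Printing Implicit Defensive.
Import Order.TTheory GRing.Theory Num.Theory.

(* Everything takes place over Q_p itself. Let g be the characteristic polynomial
   and I_k the ideal (p^k, g) of Z_p[X]; the functional X^n |-> s(n) maps I_k
   into p^k Z_p. As Z_p[X]/I_2 is finite, some U = X^T satisfies U (U - 1) in
   I_2, so the U^(p^j) tend to an idempotent E modulo g, and U^m (1 - E) lies in
   I_m. Hence s(b + T m) differs by a multiple of p^m from its E-part, on which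
   the shift by T is 1 modulo p^2; the E-part therefore has Mahler coefficients
   divisible by p^(2k) and is analytic in m. Write T = p^e t with t prime to p:
   the class of b modulo T is dense in the class of b modulo q = p^e, and on
   n = q x + r the variable m = (x - b / q) / t is an affine function of x with
   coefficients in Z_p. *)

(** * The ring of p-adic integers *)

Section PadicRing.

Variable p : nat.
Implicit Types x y z : PadicInt p.

Lemma zp_ext x y : zpv x =1 zpv y -> x = y.
Proof.
case: x y => [x xP] [y yP] /= /funext exy.
by move: xP yP; rewrite exy => xP yP; rewrite (Prop_irrelevance xP yP).
Qed.

Lemma zpv_mod x k : zpv x k %% p ^ k = zpv x k.
Proof. by have [] := zpP x k. Qed.

Lemma zpv_le_mod x j k : j <= k -> zpv x k %% p ^ j = zpv x j.
Proof.
elim: k => [|k IHk]; first by rewrite leqn0 => /eqP ->; exact: zpv_mod.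
rewrite leq_eqVlt => /orP[/eqP ->|ltjk]; first exact: zpv_mod.
have [_ e] := zpP x k; rewrite -IHk // -e.
by rewrite modn_dvdm // dvdn_exp2l.
Qed.

Lemma zpv0n x : zpv x 0 = 0.
Proof. by rewrite -(zpv_mod x) expn0 modn1. Qed.

Lemma eq_zpv_le x y j k : j <= k -> zpv x k = zpv y k -> zpv x j = zpv y j.
Proof. by move=> lejk exy; rewrite -(zpv_le_mod x lejk) exy zpv_le_mod. Qed.

(** The residues p^k - 1 represent -1, so negation can be defined as multiplication by this
    element. *)
Lemma zp_minus1_ok (p0 : 0 < p) k : (p ^ k.+1).-1 = (p ^ k).-1 %[mod p ^ k].
Proof.
have -> : (p ^ k.+1).-1 = p.-1 * p ^ k + (p ^ k).-1.
  have : 0 < p ^ k by rewrite expn_gt0 p0.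
  by rewrite expnS; case: (p) p0 => // m _; nia.
by rewrite modnMDl.
Qed.

Definition zp_opp (p0 : 0 < p) x := zp_mul (zp_mk (zp_minus1_ok p0)) x.

Lemma zp_addA : associative (@zp_add p).
Proof. by move=> x y z; apply: zp_ext => k /=; rewrite modnDml modnDmr addnA. Qed.

Lemma zp_addC : commutative (@zp_add p).
Proof. by move=> x y; apply: zp_ext => k /=; rewrite addnC. Qed.

Lemma zp_add0 : left_id (zp_of_nat p 0) (@zp_add p).
Proof. by move=> x; apply: zp_ext => k /=; rewrite mod0n add0n zpv_mod. Qed.

Lemma zp_addN (p0 : 0 < p) : left_inverse (zp_of_nat p 0) (zp_opp p0) (@zp_add p).
Proof.
move=> x; apply: zp_ext => k /=.
rewrite modnDml -modnDml modnMml modnDml -mulSnr prednK ?expn_gt0 ?p0 //.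
by rewrite modnMr mod0n.
Qed.

Lemma zp_mulA : associative (@zp_mul p).
Proof. by move=> x y z; apply: zp_ext => k /=; rewrite modnMml modnMmr mulnA. Qed.

Lemma zp_mulC : commutative (@zp_mul p).
Proof. by move=> x y; apply: zp_ext => k /=; rewrite mulnC. Qed.

Lemma zp_mul1 : left_id (zp_of_nat p 1) (@zp_mul p).
Proof. by move=> x; apply: zp_ext => k /=; rewrite modnMml mul1n zpv_mod. Qed.

Lemma zp_mulDl : left_distributive (@zp_mul p) (@zp_add p).
Proof.
by move=> x y z; apply: zp_ext => k /=; rewrite modnMml modnDm mulnDl.
Qed.

Lemma zp_one_neq0 : 1 < p -> zp_of_nat p 1 <> zp_of_nat p 0.
Proof.
by move=> p1 /(congr1 (fun z => zpv z 1)) /=; rewrite expn1 mod0n modn_small.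
Qed.

End PadicRing.

(* Carries the primality of [p], so that ring structures can be inferred. *)
Definition padic (p : nat) (hp : prime p) := PadicInt p.

(** * Z_p as a complete integral domain *)

Section PadicDomain.

Variables (p : nat) (hp : prime p).
Local Notation Zp := (padic hp).
Implicit Types x y z : Zp.

HB.instance Definition _ := gen_eqMixin Zp.
HB.instance Definition _ := gen_choiceMixin Zp.
HB.instance Definition _ := GRing.isZmodule.Build Zp
  (@zp_addA p) (@zp_addC p) (@zp_add0 p) (zp_addN (prime_gt0 hp)).

Fact padic_one_neq0 : (zp_of_nat p 1 : Zp) != 0%R.
Proof. by apply/eqP; exact: zp_one_neq0 (prime_gt1 hp). Qed.

HB.instance Definition _ := GRing.Zmodule_isComNzRing.Build Zp
  (@zp_mulA p) (@zp_mulC p) (@zp_mul1 p) (@zp_mulDl p) padic_one_neq0.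

Local Open Scope ring_scope.

Lemma zpv0 k : zpv (0 : Zp) k = 0%N.
Proof. by rewrite /= mod0n. Qed.

Lemma zpvD x y k : zpv (x + y) k = ((zpv x k + zpv y k) %% p ^ k)%N.
Proof. by []. Qed.

Lemma zpvM x y k : zpv (x * y) k = ((zpv x k * zpv y k) %% p ^ k)%N.
Proof. by []. Qed.

Lemma zpvn n k : zpv (n%:R : Zp) k = (n %% p ^ k)%N.
Proof.
elim: n => [|n IHn]; first by rewrite mod0n zpv0.
by rewrite mulrS zpvD IHn /= modnDm add1n.
Qed.

Lemma zp_of_natE n : zp_of_nat p n = n%:R :> Zp.
Proof. by apply: zp_ext => k; rewrite zpvn. Qed.

Lemma eq_zpvD x x' y y' k : zpv x k = zpv x' k -> zpv y k = zpv y' k ->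
  zpv (x + y) k = zpv (x' + y') k.
Proof. by move=> ex ey; rewrite !zpvD ex ey. Qed.

Lemma eq_zpvM x x' y y' k : zpv x k = zpv x' k -> zpv y k = zpv y' k ->
  zpv (x * y) k = zpv (x' * y') k.
Proof. by move=> ex ey; rewrite !zpvM ex ey. Qed.

Lemma zpv_subr_eq0 x y k : zpv (x - y) k = 0%N <-> zpv x k = zpv y k.
Proof.
split=> [|exy]; last first.
  by rewrite (eq_zpvD (y := - y) exy (erefl _)) subrr zpv0.
by rewrite -(zpv0 k) => e; rewrite -(subrK y x) -[in RHS](add0r y); exact: eq_zpvD.
Qed.

Lemma eq_zpv_sum (I : Type) (r : seq I) (P : pred I) (F G : I -> Zp) k :
  (forall i, P i -> zpv (F i) k = zpv (G i) k) ->
  zpv (\sum_(i <- r | P i) F i) k = zpv (\sum_(i <- r | P i) G i) k.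
Proof.
move=> eFG; elim/big_rec2: _ => // i x y Pi e.
by apply: eq_zpvD; [exact: eFG|].
Qed.

Lemma zpv_expM x k : zpv (p%:R ^+ k * x) k = 0%N.
Proof. by rewrite -natrX zpvM zpvn modnn mul0n mod0n. Qed.

Lemma zp_shift_ok x e k :
  (zpv x (k.+1 + e) %/ p ^ e = zpv x (k + e) %/ p ^ e %[mod p ^ k])%N.
Proof. by rewrite !modn_divl -expnD !zpv_le_mod // leq_add2r. Qed.

(* The Euclidean quotient of [x] by [p ^ e]. *)
Definition zp_shift e x : Zp := zp_mk (zp_shift_ok x e).

Lemma zpv_shift e x k : zpv (zp_shift e x) k = (zpv x (k + e) %/ p ^ e)%N.
Proof. by rewrite /= modn_divl -expnD zpv_mod. Qed.

Lemma zp_shift_affine e r x : (r < p ^ e)%N ->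
  zp_shift e (p%:R ^+ e * x + r%:R) = x.
Proof.
move=> ltr; have pe0 : (0 < p ^ e)%N by rewrite expn_gt0 prime_gt0.
apply: zp_ext => k; rewrite zpv_shift -natrX zpvD zpvM !zpvn.
rewrite modnMml modnDm expnD -modn_divl mulnC divnMDl //.
by rewrite divn_small // addn0 zpv_le_mod // leq_addr.
Qed.

Lemma zp_shiftK e x : zpv x e = 0%N -> p%:R ^+ e * zp_shift e x = x.
Proof.
move=> x0; apply: zp_ext => k.
rewrite -natrX zpvM zpvn zpv_shift modnMml mulnC divnK.
  by rewrite zpv_le_mod // leq_addr.
by rewrite /dvdn zpv_le_mod ?leq_addl // x0.
Qed.

Lemma zpv_eq0P x k : zpv x k = 0%N <-> exists y, x = p%:R ^+ k * y.
Proof.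
split=> [x0|[y ->]]; last exact: zpv_expM.
by exists (zp_shift k x); rewrite zp_shiftK.
Qed.

Lemma expp_mulI k x y : p%:R ^+ k * x = p%:R ^+ k * y -> x = y.
Proof.
have pk0 : (0 < p ^ k)%N by rewrite expn_gt0 prime_gt0.
move=> e; rewrite -(zp_shift_affine x pk0) -(zp_shift_affine y pk0).
by rewrite e.
Qed.

(** Completeness of Z_p in the form used throughout: the limit takes its residue modulo p^k from the
    k-th term. *)
Lemma zp_limit (u : nat -> Zp) :
  (forall k, zpv (u k.+1) k = zpv (u k) k) ->
  exists L : Zp, forall k, zpv L k = zpv (u k) k.
Proof.
move=> hu; have ok k : (zpv (u k.+1) k.+1 = zpv (u k) k %[mod p ^ k])%N.
  by rewrite zpv_le_mod // hu zpv_mod.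
by exists (zp_mk ok) => k /=; rewrite zpv_mod.
Qed.

(** Bezout inverts [x] modulo each p^k, and these inverses converge because an inverse modulo p^k is
    unique. *)
Lemma zp_invertible x : zpv x 1 != 0%N -> exists y, y * x = 1.
Proof.
move=> x1.
have inv k : exists y, zpv (y * x) k = zpv (1 : Zp) k.
  case: k => [|k]; first by exists 0; rewrite !zpv0n.
  have cop : coprime (zpv x k.+1) (p ^ k.+1).
    rewrite coprime_sym coprime_pexpl // prime_coprime //.
    by rewrite /dvdn -[X in (_ %% X)%N](expn1 p) zpv_le_mod.
  have [|a b e _] := @egcdnP (zpv x k.+1) (p ^ k.+1).
    by rewrite lt0n; apply: contraNneq x1 => x0;
       rewrite -(zpv_le_mod x (ltn0Sn k)) x0 mod0n.
  exists a%:R; rewrite zpvM zpvn modnMml e (eqP cop).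
  by rewrite modnMDl -(zpvn 1).
have [y yP] := choice inv.
have [k|L LP] := @zp_limit y.
  have e : zpv (y k.+1 * x) k = zpv (y k * x) k.
    by rewrite yP; apply: eq_zpv_le (yP k.+1).
  (* Uniqueness modulo p^k: with y = [y k] and y' = [y k.+1], y' = y' (y x) = y (y x) = y. *)
  have := eq_zpvM e (erefl (zpv (y k) k)); rewrite -!mulrA ![x * _]mulrC.
  move=> e'; rewrite -[y k.+1]mulr1 -[y k in RHS]mulr1.
  apply: (etrans _ (etrans e' _)); first exact: (eq_zpvM (erefl _) (esym (yP k))).
  exact: eq_zpvM (erefl _) (yP k).
exists L; apply: zp_ext => k; rewrite -yP; exact: eq_zpvM.
Qed.

Lemma zp_neq0P x : x != 0 -> exists k y, zpv y 1 != 0%N /\ x = p%:R ^+ k * y.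
Proof.
move=> x0; have ex : exists k, zpv x k.+1 != 0%N.
  apply/not_existsP => x_all0; case/eqP: x0; apply: zp_ext => -[|k].
    by rewrite !zpv0n.
  by rewrite zpv0; apply/eqP/negPn/negP; exact: x_all0.
have [k xk kmin] := ex_minnP ex; exists k, (zp_shift k x).
have xk0 : zpv x k = 0%N.
  case: k xk kmin => [|k] xk kmin; first exact: zpv0n.
  by apply/eqP/negPn/negP => /kmin; rewrite ltnn.
rewrite zp_shiftK //; split=> //.
apply: contraNneq xk => y0.
rewrite -(zp_shiftK xk0); have [z ->] := (zpv_eq0P _ _).1 y0.
by rewrite mulrA -exprD addn1 zpv_expM.
Qed.

(** Once the powers of p are split off and cancelled, Euclid's lemma applies to the residues modulo
    p. *)
Lemma zp_mulf_neq0 x y : x != 0 -> y != 0 -> x * y != 0.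
Proof.
move=> /zp_neq0P[j [x' [x'1 ->]]] /zp_neq0P[k [y' [y'1 ->]]].
rewrite mulrACA -exprD; apply/eqP => xy0.
have {xy0} : x' * y' = 0 by apply: (@expp_mulI (j + k)); rewrite mulr0.
move=> /(congr1 (fun z => zpv z 1)); rewrite zpv0 zpvM expn1 => /eqP.
rewrite -/(dvdn p _) Euclid_dvdM // /dvdn.
by rewrite -[X in (_ %% X)%N](expn1 p) !zpv_mod (negPf x'1) (negPf y'1).
Qed.

Definition zp_unit : {pred Zp} := fun x => `[< exists y, y * x = 1 >].

(** The value [x] off the units is the convention of the ring interface. *)
Definition zp_inv x : Zp :=
  if pselect (exists y, y * x = 1) is left ex then projT1 (cid ex) else x.

Fact zp_mulVx : {in zp_unit, left_inverse 1 zp_inv *%R}.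
Proof.
move=> x /asboolP ux; rewrite /zp_inv; case: pselect => // ex.
by case: cid.
Qed.

Fact zp_unitPl x y : y * x = 1 -> zp_unit x.
Proof. by move=> e; apply/asboolP; exists y. Qed.

Fact zp_inv_out : {in [predC zp_unit], zp_inv =1 id}.
Proof.
move=> x; rewrite !inE => /asboolPn ux; rewrite /zp_inv.
by case: pselect.
Qed.

HB.instance Definition _ := GRing.ComNzRing_hasMulInverse.Build Zp
  zp_mulVx zp_unitPl zp_inv_out.

Fact zp_idomain x y : x * y = 0 -> (x == 0) || (y == 0).
Proof.
move=> xy0; apply: contra_eqT xy0; rewrite negb_or => /andP[x0 y0].
exact: zp_mulf_neq0.
Qed.

HB.instance Definition _ := GRing.ComUnitRing_isIntegral.Build Zp zp_idomain.

Lemma zp_unit_zpv1 x : zpv x 1 != 0%N -> x \is a GRing.unit.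
Proof. by move=> /zp_invertible[y e]; apply/unitrPr; exists y; rewrite mulrC. Qed.

Lemma natr_coprime_unit t : coprime p t -> (t%:R : Zp) \is a GRing.unit.
Proof.
move=> cop; apply: zp_unit_zpv1.
by rewrite zpvn expn1 -/(dvdn p t) -prime_coprime.
Qed.

Lemma logn_fact_le n : (logn p n`! <= n)%N.
Proof.
have p2 := prime_gt1 hp.
(* Legendre's formula, with an extra tail term that closes the induction: twice the quotient of n by
   p^(N+1) is at most its quotient by p^N. *)
suff h N : (\sum_(1 <= k < N.+1) n %/ p ^ k + n %/ p ^ N <= n)%N.
  by rewrite logn_fact //; apply: leq_trans (h n); exact: leq_addr.
elim: N => [|N IHN]; first by rewrite big_geq // add0n expn0 divn1.
rewrite big_nat_recr //= -addnA; apply: leq_trans IHN; rewrite leq_add2l.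
by rewrite expnSr divnMA; move: (n %/ p ^ N)%N => m; nia.
Qed.

Lemma fact_dvd_expp n : exists w : Zp, n`!%:R * w = p%:R ^+ n.
Proof.
have [m cop e] := pfactor_coprime hp (fact_gt0 n).
exists (m%:R^-1 * p%:R ^+ (n - logn p n`!)).
rewrite {1}e natrM natrX mulrACA divrr ?natr_coprime_unit // mul1r.
by rewrite -exprD subnKC // logn_fact_le.
Qed.

Lemma zpv_horner_congr (P Q : {poly Zp}) x y k :
  (forall i, zpv P`_i k = zpv Q`_i k) -> zpv x k = zpv y k ->
  zpv P.[x] k = zpv Q.[y] k.
Proof.
move=> ePQ exy; pose n := maxn (size P) (size Q).
rewrite (horner_coef_wide _ (leq_maxl _ _ : size P <= n)%N).
rewrite (horner_coef_wide _ (leq_maxr _ _ : size Q <= n)%N).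
apply: eq_zpv_sum => i _; apply: eq_zpvM => //.
by elim: (nat_of_ord i) => [|j IHj] //; rewrite !exprS; exact: eq_zpvM.
Qed.

End PadicDomain.

Local Notation "x %:F" := (@FracField.tofrac _ x) : ring_scope.

Lemma fraction_numden (D : idomainType) (z : {fraction D}) :
  z = ((\n_(repr z))%:F / (\d_(repr z))%:F)%R.
Proof.
apply: (canRL (mulfK _)); first by rewrite tofrac_eq0 denom_ratioP.
rewrite -{1}[z]reprK; unlock FracField.tofrac.
rewrite -[LHS]FracField.pi_mul; apply/eqmodP => /=.
rewrite FracField.equivfE /FracField.mulf.
by rewrite !numden_Ratio ?mulf_neq0 ?oner_neq0 ?denom_ratioP // !mulr1 mulrC.
Qed.

(** * The p-adic absolute value on Q_p *)

Section PadicAbs.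

Variables (p : nat) (hp : prime p) (R : realType).
Local Notation Zp := (padic hp).
Local Notation Qp := {fraction Zp}.
Local Open Scope ring_scope.

(** The least k with nonzero residue modulo p^(k+1) is the valuation; it exists exactly for nonzero
    [x]. *)
Definition zp_abs (x : Zp) : R :=
  if pselect (exists k, zpv x k.+1 != 0%N) is left ex
  then (p%:R ^+ ex_minn ex)^-1 else 0.

Lemma zp_absE (x : Zp) k : zpv x k = 0%N -> zpv x k.+1 != 0%N ->
  zp_abs x = (p%:R ^+ k)^-1.
Proof.
move=> xk xk1; rewrite /zp_abs; case: pselect => [ex|[]]; last by exists k.
case: ex_minnP => m xm mmin; congr (_ ^+ _)^-1; apply/eqP.
rewrite eqn_leq mmin // leqNgt; apply/negP => ltmk; case/eqP: xm.
by rewrite (@eq_zpv_le _ x (0 : Zp) m.+1 k) // ?zpv0.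
Qed.

Lemma zp_abs0 : zp_abs 0 = 0.
Proof. by rewrite /zp_abs; case: pselect => // ex; have [k] := ex; rewrite zpv0. Qed.

Lemma p_gt0R : 0 < p%:R :> R.
Proof. by rewrite ltr0n prime_gt0. Qed.

Lemma zp_abs_expM k (x : Zp) : zpv x 1 != 0%N ->
  zp_abs (p%:R ^+ k * x) = (p%:R ^+ k)^-1.
Proof.
move=> x1; apply: zp_absE; first exact: zpv_expM.
apply: contraNneq x1 => /zpv_eq0P[y]; rewrite exprSr -mulrA.
by move=> /expp_mulI ->; rewrite -[p%:R]expr1 zpv_expM.
Qed.

Lemma zp_abs_gt0 (x : Zp) : x != 0 -> 0 < zp_abs x.
Proof.
move=> /zp_neq0P[k [y [y1 ->]]]; rewrite zp_abs_expM //.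
by rewrite invr_gt0 exprn_gt0 // p_gt0R.
Qed.

Lemma zp_abs_ge0 (x : Zp) : 0 <= zp_abs x.
Proof. by have [->|/zp_abs_gt0/ltW//] := eqVneq x 0; rewrite zp_abs0. Qed.

Lemma zp_absM (x y : Zp) : zp_abs (x * y) = zp_abs x * zp_abs y.
Proof.
have [->|/zp_neq0P[j [x' [x1 ->]]]] := eqVneq x 0.
  by rewrite mul0r zp_abs0 mul0r.
have [->|/zp_neq0P[k [y' [y1 ->]]]] := eqVneq y 0.
  by rewrite mulr0 zp_abs0 mulr0.
rewrite mulrACA -exprD !zp_abs_expM // -?invfM -?exprD //.
rewrite zpvM expn1 -/(dvdn p _) Euclid_dvdM // /dvdn.
by rewrite -[X in (_ %% X)%N](expn1 p) !zpv_mod (negPf x1) (negPf y1).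
Qed.

Lemma zp_abs_le (x : Zp) k : zpv x k = 0%N -> zp_abs x <= (p%:R ^+ k)^-1.
Proof.
have [-> _|/zp_neq0P[j [y [y1 ->]]] xk] := eqVneq x 0.
  by rewrite zp_abs0 invr_ge0 exprn_ge0 // ltW // p_gt0R.
have lekj : (k <= j)%N.
  rewrite leqNgt; apply/negP => ltjk.
  have : zpv (p%:R ^+ j * y) j.+1 = zpv (0 : Zp) j.+1.
    by apply: eq_zpv_le ltjk _; rewrite zpv0.
  rewrite zpv0 => /zpv_eq0P[z]; rewrite exprSr -mulrA => /expp_mulI e.
  by move: y1; rewrite e -[p%:R]expr1 zpv_expM.
rewrite zp_abs_expM // lef_pV2 ?posrE ?exprn_gt0 ?p_gt0R //.
by rewrite ler_eXn2l ?ltr1n ?prime_gt1.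
Qed.

Lemma zp_absD (x y : Zp) : zp_abs (x + y) <= zp_abs x + zp_abs y.
Proof.
wlog lexy : x y / zp_abs x <= zp_abs y => [hw|].
  have [/hw //|/ltW/hw] := lerP (zp_abs x) (zp_abs y).
  by rewrite addrC [zp_abs y + _]addrC.
(* The stronger ultrametric bound: when |y| = p^-k is the larger value, p^k divides both terms. *)
suff: zp_abs (x + y) <= zp_abs y by move/le_trans; apply; rewrite lerDr zp_abs_ge0.
have [y0|] := eqVneq y 0.
  have [-> |/zp_abs_gt0] := eqVneq x 0; first by rewrite add0r.
  by rewrite ltNge (le_trans lexy) // y0 zp_abs0.
move=> /zp_neq0P[k [z [z1 ey]]].
have abs_y : zp_abs y = (p%:R ^+ k)^-1 by rewrite ey zp_abs_expM.
rewrite abs_y; apply: zp_abs_le; rewrite zpvD ey zpv_expM addn0.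
suff -> : zpv x k = 0%N by rewrite mod0n.
have [->|/zp_neq0P[j [w [w1 ex]]]] := eqVneq x 0; first by rewrite zpv0.
move: lexy; rewrite abs_y ex zp_abs_expM //.
rewrite lef_pV2 ?posrE ?exprn_gt0 ?p_gt0R // ler_eXn2l ?ltr1n ?prime_gt1 //.
by move=> lekj; rewrite -(subnKC lekj) exprD -mulrA zpv_expM.
Qed.

Definition qp_abs (z : Qp) : R :=
  zp_abs (\n_(repr z)) / zp_abs (\d_(repr z)).

(** Cross-multiplication and multiplicativity make the value independent of the representative
    chosen in [qp_abs]. *)
Lemma qp_abs_frac (a b : Zp) : b != 0 -> qp_abs (a%:F / b%:F) = zp_abs a / zp_abs b.
Proof.
move=> b0; rewrite /qp_abs; set z : Qp := a%:F / b%:F.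
have d0 : \d_(repr z) != 0 by exact: denom_ratioP.
have e : \n_(repr z) * b = a * \d_(repr z).
  apply/eqP; rewrite -tofrac_eq !tofracM -eqr_div ?tofrac_eq0 //.
  by rewrite -fraction_numden.
by apply/eqP; rewrite eqr_div -?zp_absM ?e // gt_eqF // zp_abs_gt0.
Qed.

Lemma qp_abs_tofrac (a : Zp) : qp_abs a%:F = zp_abs a.
Proof.
have abs1 : zp_abs 1 = 1.
  have /mulfI : zp_abs 1 != 0 by rewrite gt_eqF // zp_abs_gt0 ?oner_neq0.
  by apply; rewrite -zp_absM !mulr1.
by rewrite -[a%:F]divr1 -tofrac1 qp_abs_frac ?oner_neq0 // abs1 divr1.
Qed.

Lemma qp_is_absval : is_absval qp_abs.
Proof.
have fracP (z : Qp) : exists a b : Zp, b != 0 /\ z = a%:F / b%:F.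
  exists \n_(repr z), \d_(repr z).
  by split; [exact: denom_ratioP | exact: fraction_numden].
split=> [z|z|z w|z w].
- by rewrite divr_ge0 ?zp_abs_ge0.
- have [a [b [b0 ->]]] := fracP z; rewrite qp_abs_frac //.
  have absb : zp_abs b != 0 by rewrite gt_eqF // zp_abs_gt0.
  split=> [/eqP|/eqP].
    rewrite mulf_eq0 invr_eq0 (negPf absb) orbF => absa.
    have [->|/zp_abs_gt0] := eqVneq a 0; first by rewrite tofrac0 mul0r.
    by rewrite (eqP absa) ltxx.
  rewrite mulf_eq0 invr_eq0 !tofrac_eq0 (negPf b0) orbF => /eqP ->.
  by rewrite zp_abs0 mul0r.
- have [a [b [b0 ->]]] := fracP z; have [c [d [d0 ->]]] := fracP w.
  rewrite mulf_div -!tofracM !qp_abs_frac ?mulf_neq0 //.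
  by rewrite !zp_absM mulf_div.
have [a [b [b0 ->]]] := fracP z; have [c [d [d0 ->]]] := fracP w.
have [absb absd] : zp_abs b != 0 /\ zp_abs d != 0 by rewrite !gt_eqF // zp_abs_gt0.
rewrite addf_div ?tofrac_eq0 // -!tofracM -tofracD !qp_abs_frac ?mulf_neq0 //.
rewrite addf_div // -!zp_absM ler_pM2r ?zp_absD //.
by rewrite invr_gt0 zp_abs_gt0 // mulf_neq0.
Qed.

Lemma qp_finite_ext : finite_ext_Qp (fun x : PadicInt p => (x : Zp)%:F) qp_abs.
Proof.
split; first 1 last.
- exact: qp_is_absval.
- by move=> a k ak ak1; rewrite qp_abs_tofrac; exact: zp_absE.
(* The basis is 1; [k] is the valuation of the denominator, whose unit part is inverted in Z_p. *)
- exists 1%N, (fun=> 1) => z.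
  set b := \d_(repr z); have b0 : b != 0 by exact: denom_ratioP.
  have [k [u [u1 eb]]] := zp_neq0P b0.
  have uu : u \is a GRing.unit by exact: zp_unit_zpv1.
  exists (fun=> \n_(repr z) / u), k.
  rewrite big_ord1 mulr1 [in LHS](fraction_numden z) -/b mulrA.
  apply: (mulIf (_ : b%:F != 0)); first by rewrite tofrac_eq0.
  rewrite divfK ?tofrac_eq0 // -tofracM eb mulrCA divrK //.
  by rewrite tofracM tofracXn rmorph_nat.
by split=> [|x y|x y]; [exact: tofrac1|exact: tofracD|exact: tofracM].
Qed.

End PadicAbs.

(** * Powers of X modulo p^k and the characteristic polynomial *)

Section ModIdeal.

Variables (p : nat) (hp : prime p) (g : {poly padic hp}).
Local Notation Zp := (padic hp).
Implicit Types P Q U : {poly Zp}.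
Local Open Scope ring_scope.

Definition in_ideal k P := exists A B : {poly Zp}, P = A *+ p ^ k + B * g.

Lemma in_ideal_expM k A : in_ideal k (A *+ p ^ k).
Proof. by exists A, 0; rewrite mul0r addr0. Qed.

Lemma in_ideal0 P : in_ideal 0 P.
Proof. by rewrite -[P]mulr1n -(expn0 p); exact: in_ideal_expM. Qed.

Lemma in_idealD k P Q : in_ideal k P -> in_ideal k Q -> in_ideal k (P + Q).
Proof.
move=> [A [B ->]] [A' [B' ->]]; exists (A + A'), (B + B').
by rewrite mulrnDl mulrDl addrACA.
Qed.

Lemma in_idealMl k P Q : in_ideal k Q -> in_ideal k (P * Q).
Proof.
move=> [A [B ->]]; exists (P * A), (P * B).
by rewrite mulrDr mulrnAr mulrA.
Qed.

Lemma in_idealMr k P Q : in_ideal k P -> in_ideal k (P * Q).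
Proof. by rewrite mulrC; exact: in_idealMl. Qed.

Lemma in_idealN k P : in_ideal k P -> in_ideal k (- P).
Proof. by rewrite -mulN1r; exact: in_idealMl. Qed.

(** Every term of the expanded product except the one with p^j p^k contains g. *)
Lemma in_idealM j k P Q : in_ideal j P -> in_ideal k Q -> in_ideal (j + k) (P * Q).
Proof.
move=> [A [B ->]] [A' [B' ->]].
exists (A * A'), (A *+ p ^ j * B' + B * (A' *+ p ^ k + B' * g)).
rewrite expnD mulrnA mulrDl mulrDr -[in RHS]mulrnAr -mulrnAl; ring.
Qed.

Lemma in_ideal_le j k P : (j <= k)%N -> in_ideal k P -> in_ideal j P.
Proof.
move=> lejk [A [B ->]]; exists (A *+ p ^ (k - j)), B.
by rewrite -mulrnA -expnD subnK.
Qed.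

Lemma in_ideal_exp k P n : in_ideal k P -> in_ideal (k * n) (P ^+ n).
Proof.
move=> hP; elim: n => [|n IHn]; first by rewrite muln0; exact: in_ideal0.
by rewrite exprS mulnS; exact: in_idealM.
Qed.

(* With [y = U ^+ p ^ j], the factor [1 + y + ... + y ^+ p.-1] of
   [y ^+ p - 1] is [p] plus a multiple of [y - 1], which gains one power of
   [p] after multiplication by [U]. *)
Lemma idempotent_power_gap U j : in_ideal 2 (U * (U - 1)) ->
  in_ideal j (U ^+ j * (U ^+ (p ^ j) - 1)).
Proof.
move=> hU; elim: j => [|j IHj]; first exact: in_ideal0.
set y := U ^+ (p ^ j).
have -> : U ^+ (p ^ j.+1) = y ^+ p by rewrite expnSr exprM.
rewrite subrX1 exprSr mulrACA -addn1; apply: in_idealM => //.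
have -> : \sum_(i < p) y ^+ i = p%:R + \sum_(i < p) (y ^+ i - 1).
  rewrite big_split /= sumr_const card_ord mulNrn.
  by rewrite [RHS]addrC subrK.
rewrite mulrDr; apply: in_idealD.
  by rewrite mulr_natr -{2}(expn1 p); exact: in_ideal_expM.
rewrite mulr_sumr; elim/big_rec: _ => [|i Q _].
  by rewrite -(mul0rn _ (p ^ 1)); exact: in_ideal_expM.
apply: in_idealD; rewrite /y -exprM subrX1 mulrA.
by apply: in_idealMr; apply: in_ideal_le hU.
Qed.

Lemma zpv_coef_in_ideal P k : (forall i, zpv P`_i k = 0%N) -> in_ideal k P.
Proof.
move=> P0; exists (\poly_(i < size P) zp_shift k P`_i), 0.
rewrite mul0r addr0; apply/polyP => i; rewrite coefMn coef_poly.
case: ltnP => [_|sP]; last by rewrite mul0rn nth_default.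
by rewrite -mulr_natl natrX zp_shiftK.
Qed.

(** By pigeonhole, two powers X^m and X^n have remainders modulo g that agree modulo p^2, so X^n -
    X^m lies in I_2. *)
Lemma exists_idempotent_power : g \is monic ->
  exists2 T, (0 < T)%N & in_ideal 2 ('X^T * ('X^T - 1)).
Proof.
move=> gmon; have g0 := monic_neq0 gmon.
pose rem n : {poly Zp} := Pdiv.Ring.rmodp ('X^n : {poly Zp}) g.
(* The successor form of p^2 is what [inord] requires. *)
pose l := size g; pose N := (p ^ 2).-1.
have N1 : N.+1 = (p ^ 2)%N by rewrite prednK // expn_gt0 prime_gt0.
pose res n : {ffun 'I_l -> 'I_N.+1} := [ffun i : 'I_l => inord (zpv (rem n)`_i 2)].
have [m [n [ltmn eres]]] : exists m n, (m < n)%N /\ res m = res n.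
  pose M := #|{ffun 'I_l -> 'I_N.+1}|.
  have /injectivePn[i [j ij e]] : ~~ injectiveb (fun i : 'I_M.+1 => res i).
    by apply/injectiveP => /leq_card; rewrite card_ord ltnn.
  have [ltij|ltji|eij] := ltngtP i j.
  - by exists i, j.
  - by exists j, i.
  by case/eqP: ij; exact: val_inj.
have remE k (i : nat) : (zpv ((rem k)`_i)%R 2 < N.+1)%N.
  by rewrite N1 -zpv_mod ltn_mod expn_gt0 prime_gt0.
have hd : in_ideal 2 ('X^n - 'X^m).
  rewrite (Pdiv.RingMonic.rdivp_eq gmon 'X^n) (Pdiv.RingMonic.rdivp_eq gmon 'X^m).
  rewrite opprD addrACA -mulrBl; apply: in_idealD.
    by exists 0; eexists; rewrite mul0rn add0r.
  apply: zpv_coef_in_ideal => i; rewrite coefB; apply/zpv_subr_eq0.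
  have [lti|lei] := ltnP i l; last first.
    by rewrite !nth_default ?zpv0 //; apply: leq_trans lei; apply: ltnW;
       rewrite Pdiv.Ring.ltn_rmodpN0.
  have /ffunP/(_ (Ordinal lti)) := eres; rewrite !ffunE /= => /(congr1 val) /=.
  by rewrite !inordK ?remE // => ->.
have T00 : (0 < n - m)%N by rewrite subn_gt0.
(* A multiple of n - m that is at least m: then X^T (X^T - 1) is a multiple of X^m (X^(n-m) - 1) =
   X^n - X^m. *)
exists ((n - m) * m.+1)%N; first by rewrite muln_gt0 T00.
set T := (_ * _)%N; have leT : (m <= T)%N by rewrite /T; nia.
have -> : 'X^T * ('X^T - 1) = ('X^n - 'X^m) *
    ('X^(T - m) * \sum_(i < m.+1) 'X^(n - m) ^+ i) :> {poly Zp}.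
  have eT1 : 'X^T - 1 = ('X^(n - m) - 1) * \sum_(i < m.+1) 'X^(n - m) ^+ i :> {poly Zp}.
    by rewrite -subrX1 -exprM.
  have eT : 'X^T = 'X^m * 'X^(T - m) :> {poly Zp} by rewrite -exprD subnKC.
  have en : 'X^n = 'X^m * 'X^(n - m) :> {poly Zp} by rewrite -exprD subnKC // ltnW.
  by rewrite eT1 eT en; ring.
exact: in_idealMr.
Qed.

End ModIdeal.

(** * The recurrence as a functional on polynomials *)

Section LinearRecurrence.

Variables (p : nat) (hp : prime p).
Local Notation Zp := (padic hp).
Variables (l : nat) (a : 'I_l -> Zp) (s : nat -> Zp).
Implicit Types P Q U : {poly Zp}.
Local Open Scope ring_scope.

Definition recpoly : {poly Zp} := 'X^l + \sum_(i < l) a i *: 'X^i.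

Lemma recpoly_monic : recpoly \is monic.
Proof.
rewrite monicE /recpoly lead_coefDl ?lead_coefXn // size_polyXn ltnS.
apply: (leq_trans (size_sum _ _ _)); apply/bigmax_leqP => i _.
by rewrite (leq_trans (size_scale_leq _ _)) // size_polyXn.
Qed.

Definition seq_eval P := \sum_(i < size P) P`_i * s i.

Lemma seq_eval_wide n P : (size P <= n)%N -> seq_eval P = \sum_(i < n) P`_i * s i.
Proof.
move=> leP; rewrite /seq_eval (big_ord_widen n (fun i => P`_i * s i)) //.
rewrite big_mkcond; apply: eq_bigr => i _; case: ltnP => // sP.
by rewrite nth_default // mul0r.
Qed.

Fact seq_eval_is_linear : linear_for *%R seq_eval.
Proof.
move=> c P Q; pose n := maxn (size (c *: P + Q)) (maxn (size P) (size Q)).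
rewrite !(@seq_eval_wide n) ?leq_max ?leqnn ?orbT //.
rewrite mulr_sumr -big_split; apply: eq_bigr => i _ /=.
by rewrite coefD coefZ mulrDl mulrA.
Qed.
HB.instance Definition _ := GRing.isLinear.Build Zp {poly Zp} Zp *%R seq_eval
  seq_eval_is_linear.

Lemma seq_evalXn n : seq_eval 'X^n = s n.
Proof.
rewrite /seq_eval size_polyXn big_ord_recr /= coefXn eqxx mul1r.
by rewrite big1 ?add0r // => i _; rewrite coefXn ltn_eqF ?mul0r.
Qed.

Hypothesis s_rec : forall n, s (n + l) + \sum_(i < l) a i * s (n + i) = 0.

(** By linearity it suffices to take Q = X^j, where the claim is the recurrence at index j. *)
Lemma seq_eval_recpoly Q : seq_eval (Q * recpoly) = 0.
Proof.
rewrite -[Q]coefK poly_def mulr_suml linear_sum big1 // => j _.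
rewrite -scalerAl linearZ /recpoly mulrDr mulr_sumr linearD linear_sum /=.
rewrite -exprD seq_evalXn; set S := \sum_(i < l) _.
suff -> : S = \sum_(i < l) a i * s (j + i) by rewrite s_rec mulr0.
apply: eq_bigr => i _; rewrite -scalerAr linearZ /= -exprD.
by rewrite seq_evalXn.
Qed.

Lemma zpv_seq_eval k P : in_ideal recpoly k P -> zpv (seq_eval P) k = 0%N.
Proof.
move=> [A [B ->]].
have -> : seq_eval (A *+ p ^ k + B * recpoly) = p%:R ^+ k * seq_eval A.
  by rewrite linearD /= seq_eval_recpoly addr0 linearMn -natrX mulr_natl.
exact: zpv_expM.
Qed.

Variable T : nat.
Hypothesis idemT : in_ideal recpoly 2 ('X^T * ('X^T - 1)).

(* [(X^T) ^+ (p ^ j)] tends to an idempotent [E]; the [d k] are the Mahler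
   coefficients of [m |-> E s (b + T * m)], the part of the sequence on which
   the shift is invertible. *)
Lemma approx_mahler_expansion b : exists d : nat -> Zp,
  (forall k, zpv (d k) (2 * k) = 0%N) /\
  (forall m, zpv (s (b + T * m)) m = zpv (\sum_(k < m.+1) d k *+ 'C(m, k)) m).
Proof.
pose U : {poly Zp} := 'X^T.
have idemU : in_ideal recpoly 2 (U * (U - 1)) by exact: idemT.
have ltp j : (j < p ^ j)%N by rewrite ltn_expl // prime_gt1.
(* The value of the functional at X^b (U - 1)^k E, with E replaced by its approximation U^(p^j). *)
pose u k j := seq_eval ('X^b * (U - 1) ^+ k * U ^+ (p ^ j)).
have u_lim k : exists L : Zp, forall j, zpv L j = zpv (u k j) j.
  apply: zp_limit => j; apply/zpv_subr_eq0; rewrite -linearB -mulrBr.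
  apply: zpv_seq_eval; apply: in_idealMl.
  (* With y = U^(p^j), y^p - y = y (y - 1) (1 + ... + y^(p-2)); since j < p^j, y supplies the factor
     U^j required by [idempotent_power_gap]. *)
  have -> : U ^+ (p ^ j.+1) - U ^+ (p ^ j) = U ^+ (p ^ j - j) *
      (U ^+ j * (U ^+ (p ^ j) - 1)) * \sum_(i < p.-1) U ^+ (p ^ j) ^+ i.
    rewrite mulrA -exprD subnK ?(ltnW (ltp j)) // -mulrA -subrX1 mulrBr mulr1.
    by rewrite -exprS prednK ?prime_gt0 // expnSr exprM.
  by apply: in_idealMr; apply: in_idealMl; exact: idempotent_power_gap.
have [d dP] := choice u_lim; exists d; split=> [k|m].
  (* At level j = 2k, the power U^(p^(2k)) contains U^k, which pairs with (U - 1)^k to give (U (U -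
     1))^k in I_(2k). *)
  rewrite dP; apply: zpv_seq_eval; rewrite -mulrA; apply: in_idealMl.
  have le2k : (k <= p ^ (2 * k))%N by rewrite (leq_trans _ (ltnW (ltp _))) ?leq_pmull.
  rewrite -(subnK le2k) exprD [_ * U ^+ k]mulrC mulrA -exprMn.
  by apply: in_idealMr; apply: in_ideal_exp; rewrite mulrC.
have -> : zpv (\sum_(k < m.+1) d k *+ 'C(m, k)) m =
          zpv (\sum_(k < m.+1) u k m *+ 'C(m, k)) m.
  apply: eq_zpv_sum => k _; rewrite -[d k *+ _]mulr_natr -[u k m *+ _]mulr_natr.
  by apply: eq_zpvM => //; exact: dP.
(* Expanding U^m = (1 + (U - 1))^m resums the series; the error comes from U^m (1 - U^(p^m)), which
   lies in I_m. *)
suff -> : \sum_(k < m.+1) u k m *+ 'C(m, k) =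
          seq_eval ('X^b * U ^+ m * U ^+ (p ^ m)).
  apply/zpv_subr_eq0; rewrite -seq_evalXn exprD exprM -/U -linearB.
  rewrite -{1}['X^b * U ^+ m]mulr1 -mulrBr -opprB mulrN -mulrA -mulrN.
  apply: zpv_seq_eval; apply: in_idealMl; apply: in_idealN.
  exact: idempotent_power_gap.
have -> : U ^+ m = \sum_(k < m.+1) (U - 1) ^+ k *+ 'C(m, k).
  rewrite -{1}(subrK 1 U) addrC exprDn; apply: eq_bigr => k _.
  by rewrite expr1n mul1r.
rewrite mulr_sumr mulr_suml linear_sum; apply: eq_bigr => k _ /=.
by rewrite mulrnAr mulrnAl linearMn.
Qed.

End LinearRecurrence.

(** * Analytic interpolation of Mahler series *)

Section MahlerAnalytic.

Variables (p : nat) (hp : prime p).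
Local Notation Zp := (padic hp).
Local Open Scope ring_scope.

Lemma prod_sub_ffact (D : comNzRingType) (m k : nat) :
  \prod_(i < k) (m%:R - i%:R) = (m ^_ k)%:R :> D.
Proof.
elim: k => [|k IHk]; first by rewrite big_ord0 ffactn0.
rewrite big_ord_recr /= IHk ffactnSr natrM.
have [lekm|ltmk] := leqP k m; first by rewrite natrB.
by rewrite ffact_small // !mul0r.
Qed.

(* [m = (x - c) / t] is substituted in the Mahler series; the factor
   [p ^ (2 k)] beats the denominator [k!] of the k-th binomial polynomial and
   leaves [p ^ k], so the rearranged power series converges on [Zp]. *)
Lemma mahler_analytic (d : nat -> Zp) (c t : nat) : coprime p t ->
  (forall k, zpv (d k) (2 * k) = 0%N) ->
  exists (F : Zp -> Zp) (co : nat -> Zp),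
    (forall x M, zpv (F x) M = zpv (\sum_(m < M) co m * x ^+ m) M) /\
    (forall m, F (c + t * m)%:R = \sum_(k < m.+1) d k *+ 'C(m, k)).
Proof.
move=> cop hd; have tu := natr_coprime_unit hp cop.
(* If d_k = p^(2k) y and k! w = p^k, then d_k = k! (p^k w y). *)
have eps_ex k : exists e : Zp, d k = e *+ k`! /\ zpv e k = 0%N.
  have [y ->] := (zpv_eq0P _ _).1 (hd k); have [w ew] := fact_dvd_expp hp k.
  exists (p%:R ^+ k * (w * y)); split; last exact: zpv_expM.
  by rewrite mul2n -addnn exprD -{2}ew -!mulrA mulrCA mulr_natl.
have [e eP] := choice eps_ex.
(* At x = c + t m this is the falling factorial of m; its coefficients are integral because t is a
   unit. *)
pose P k : {poly Zp} := \prod_(i < k) (t%:R^-1 *: ('X - c%:R%:P) - i%:R%:P).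
have sizeP k : (size (P k) <= k.+1)%N.
  rewrite /P; elim: k => [|k IHk]; first by rewrite big_ord0 size_poly1.
  rewrite big_ord_recr /=; apply: (leq_trans (size_polyMleq _ _)).
  set A := _ - k%:R%:P.
  have sA : (size A <= 2)%N.
    apply: (leq_trans (size_polyD _ _)); rewrite geq_max.
    rewrite (leq_trans (size_scale_leq _ _)) ?size_XsubC //.
    by rewrite size_polyN (leq_trans (size_polyC_leq1 _)).
  by rewrite -subn1 leq_subLR (leq_trans (leq_add IHk sA)) // addn2.
(* As p^k divides [e k], passing from [Q M] to [Q M.+1] changes nothing modulo p^M, so both
   coefficients and values converge. *)
pose Q M := \sum_(k < M) e k *: P k.
have sizeQ M : (size (Q M) <= M)%N.
  apply: (leq_trans (size_sum _ _ _)); apply/bigmax_leqP => i _.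
  by rewrite (leq_trans (size_scale_leq _ _)) // (leq_trans (sizeP _)).
have Qcong M i : zpv (Q M.+1)`_i M = zpv (Q M)`_i M.
  rewrite /Q big_ord_recr /= coefD coefZ; apply/zpv_subr_eq0.
  rewrite addrC addKr; have [_ /zpv_eq0P[z ->]] := eP M.
  by rewrite -mulrA zpv_expM.
have co_ex i : exists z : Zp, forall M, zpv z M = zpv (Q M)`_i M.
  by apply: zp_limit => M; exact: Qcong.
have F_ex x : exists z : Zp, forall M, zpv z M = zpv (Q M).[x] M.
  by apply: zp_limit => M; exact: zpv_horner_congr.
have [co coP] := choice co_ex; have [F FP] := choice F_ex.
exists F, co; split=> [x M|m].
  rewrite FP (horner_coef_wide _ (sizeQ M)); apply: eq_zpv_sum => i _.
  by apply: eq_zpvM => //; rewrite coP.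
have Px k : (P k).[(c + t * m)%:R] = (m ^_ k)%:R.
  rewrite -prod_sub_ffact horner_prod; apply: eq_bigr => i _.
  by rewrite !hornerE natrD natrM [c%:R + _]addrC addrK mulKr.
(* The precision is raised to M + m + 1 so that the partial sum contains every k up to m; the later
   terms vanish at x = c + t m. *)
apply: zp_ext => M; apply: (@eq_zpv_le _ _ _ _ (M + m.+1)); first exact: leq_addr.
rewrite FP /Q horner_sum; congr (zpv _ _).
rewrite addnC big_split_ord /= [X in _ + X]big1 ?addr0 => [|i _].
  apply: eq_bigr => k _; rewrite hornerZ Px (eP k).1 -mulrnA mulr_natr.
  by rewrite mulnC bin_ffact.
by rewrite hornerZ Px ffact_small ?mulr0 // ltn_addr.
Qed.

End MahlerAnalytic.

(** * Comparison of p^-m with a geometric sequence *)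

Section Decay.

Variable R : realType.
Local Open Scope ring_scope.

Lemma expp_inv_lt (p : nat) (eps : R) : (1 < p)%N -> 0 < eps ->
  exists N, forall M, (N <= M)%N -> (p%:R ^+ M)^-1 < eps.
Proof.
move=> p1 eps0; exists (Num.Def.archi_bound eps^-1) => M leM.
rewrite invf_plt ?posrE ?exprn_gt0 ?ltr0n ?(ltnW p1) //.
apply: (lt_le_trans (archi_boundP _)); first by rewrite invr_ge0 ltW.
by rewrite -natrX ler_nat (leq_trans leM) // ltnW // ltn_expl.
Qed.

Lemma bernoulli_ineq (x : R) n : 0 <= x <= 1 -> 1 - n%:R * x <= (1 - x) ^+ n.
Proof.
move=> /andP[x0 x1]; elim: n => [|n IHn]; first by rewrite mul0r subr0 expr0.
have n0 : 0 <= n%:R :> R by rewrite ler0n.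
rewrite exprS -natr1; apply: (@le_trans _ _ ((1 - x) * (1 - n%:R * x))); first nra.
by rewrite ler_wpM2l // subr_ge0.
Qed.

(* By Bernoulli's inequality, [D = 1 - 1 / (2 T)] satisfies [1 / 2 <= D ^ T]. *)
Lemma exp_decay (p T : nat) : (1 < p)%N -> (0 < T)%N ->
  exists C D : R, [/\ 0 <= C, 0 <= D, D < 1 &
    forall b m, (b < T)%N -> (p%:R ^+ m)^-1 <= C * D ^+ (b + T * m)].
Proof.
move=> p1 T0; have T1 : 1 <= T%:R :> R by rewrite ler1n.
have T0R : 0 < T%:R :> R by rewrite ltr0n.
pose y : R := (2 * T%:R)^-1.
have y0 : 0 < y by rewrite invr_gt0 mulr_gt0.
have Ty : T%:R * y = 2^-1 by rewrite /y invfM mulrCA divff ?mulr1 ?gt_eqF.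
have y1 : y <= 2^-1 by rewrite -Ty ler_peMl // ltW.
have D01 : 0 <= 1 - y <= 1 by apply/andP; split; lra.
have [D0 D1] := andP D01.
have DT : 2^-1 <= (1 - y) ^+ T.
  have := @bernoulli_ineq y T; rewrite Ty => h.
  by apply: le_trans (h _); [lra | apply/andP; split; lra].
(* The constant 2 compensates the factor D^b, which is at least D^T and hence at least 1/2 when b <
   T. *)
exists 2, (1 - y); split=> [|||b m ltb]; try lra.
have Db : 2^-1 <= (1 - y) ^+ b.
  by apply: (le_trans DT); apply: ler_wiXn2l => //; exact: ltnW.
rewrite exprD exprM mulrA.
have h1 : 1 <= 2 * (1 - y) ^+ b by lra.
rewrite -[leLHS]mul1r ler_pM ?invr_ge0 ?exprn_ge0 ?ler0n //.
rewrite -exprVn lerXn2r ?nnegrE ?invr_ge0 ?ler0n ?exprn_ge0 //.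
apply: le_trans DT; rewrite lef_pV2 ?posrE ?ltr0n ?(ltnW p1) //.
by rewrite ler_nat.
Qed.

End Decay.

(** * Assembly of the interpolation from the residue classes modulo T *)

Theorem theorem3p4 (p : nat) (hp : prime p) (R : realType)
  (s : nat -> PadicInt p) (l : nat) (a : 'I_l -> PadicInt p)
  (hrec : forall n k,
     (zpv (s (n + l)) k + \sum_(i < l) zpv (a i) k * zpv (s (n + i)) k)
       %% p ^ k = 0) :
  exists (K : fieldType) (iota : PadicInt p -> K) (absK : K -> R),
    finite_ext_Qp iota absK /\
    exists (q : nat) (J : finType) (A : J -> pred nat) (r : J -> nat)
           (sj : J -> PadicInt p -> K),
      approx_twisted_interp iota absK s q A r sj /\
      interp_analytic iota absK q r sj.
Proof.
pose Zp := padic hp.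
have p1 := prime_gt1 hp.
have s_rec (n : nat) : ((s (n + l) : Zp) + \sum_(i < l) (a i : Zp) * (s (n + i)) = 0)%R.
  apply: zp_ext => k; rewrite zpv0 -(hrec n k) zpvD -[RHS]modnDmr.
  congr ((_ + _) %% _); elim/big_rec2: _ => [|i x y _ IH]; first by rewrite zpv0 mod0n.
  by rewrite zpvD zpvM IH modnDm.
have [T T0 idemT] := exists_idempotent_power (recpoly_monic (a : 'I_l -> Zp)).
have [t cop eT] := pfactor_coprime hp T0; set e := logn p T in eT.
have q0 : 0 < p ^ e by rewrite expn_gt0 prime_gt0.
have F_ex (b : 'I_T) : exists Fco : (Zp -> Zp) * (nat -> Zp),
    (forall x M, zpv (Fco.1 x) M = zpv (\sum_(m < M) Fco.2 m * x ^+ m)%R M) /\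
    (forall m, zpv (s (b + T * m)) m = zpv (Fco.1 (b %/ p ^ e + t * m)%:R%R) m).
  have [d [d0 dP]] := approx_mahler_expansion s_rec idemT b.
  have [F [co [Fco FP]]] := mahler_analytic (b %/ p ^ e) cop d0.
  by exists (F, co); split=> // m; rewrite dP -FP.
have [Fco FcoP] := choice F_ex.
pose F b := (Fco b).1.
have F_cont b x y k : zpv x k = zpv y k -> zpv (F b x) k = zpv (F b y) k.
  move=> exy; rewrite !(FcoP b).1; apply: eq_zpv_sum => i _.
  apply: eq_zpvM => //; elim: (nat_of_ord i) => // j IHj.
  by rewrite !exprS; exact: eq_zpvM.
pose iota (x : PadicInt p) : {fraction Zp} := (x : Zp)%:F%R.
have abs_le (x y : Zp) k : zpv x k = zpv y k ->
    (qp_abs R (iota x - iota y) <= (p%:R ^+ k)^-1)%R.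
  move=> exy; rewrite /iota -tofracB qp_abs_tofrac; apply: zp_abs_le.
  exact/zpv_subr_eq0.
have affineE r (x : PadicInt p) :
    zp_affine (p ^ e) r x = (p%:R ^+ e * (x : Zp) + r%:R)%R :> Zp.
  by rewrite -natrX -!zp_of_natE.
exists {fraction Zp}, iota, (@qp_abs p hp R); split; first exact: qp_finite_ext.
(* The pieces are the classes modulo T, several of which may share a coset modulo q. On r + q Z_p,
   [zp_shift e] is y -> (y - r) / q. *)
exists (p ^ e), 'I_T, (fun (b : 'I_T) n => n %% T == b),
  (fun b : 'I_T => b %% p ^ e), (fun b y => iota (F b (zp_shift e (y : Zp)))).
split; last first.
  move=> b; exists (fun m => iota ((Fco b).2 m)) => x eps eps0.
  have [N hN] := expp_inv_lt p1 eps0; exists N => M leNM.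
  apply: le_lt_trans (hN M leNM).
  rewrite affineE zp_shift_affine ?ltn_mod //.
  have -> : (\sum_(m < M) iota ((Fco b).2 m) * iota x ^+ m)%R =
            iota (\sum_(m < M) (Fco b).2 m * (x : Zp) ^+ m)%R.
    rewrite /iota rmorph_sum; apply: eq_bigr => m _.
    by rewrite rmorphM rmorphXn.
  by apply: abs_le; rewrite (FcoP b).1.
split.
- by split=> //; exists e.
- move=> n; exists (Ordinal (ltn_pmod n T0)); split=> // b /eqP e_b.
  exact: val_inj.
- move=> b; split; first by rewrite ltn_mod.
  have b_affine n : n %% T == b -> n = (n %/ p ^ e) * p ^ e + b %% p ^ e.
    move=> /eqP <-; rewrite {1}(divn_eq n (p ^ e)); congr (_ + _).
    by rewrite modn_dvdm // eT dvdn_mull.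
  split=> [n An|x [y exy] k].
    exists ((n %/ p ^ e)%:R : Zp)%R => k; rewrite affineE {1}(b_affine n An).
    by rewrite zp_of_natE natrD natrM natrX mulrC.
  (* The Chinese remainder theorem gives n = x modulo p^(k+e) and n = b modulo t. The e extra digits
     force n = x = b modulo q even for small k, hence n = b modulo T. *)
  pose n := chinese (p ^ (k + e)) t (zpv x (k + e)) b.
  have cop' : coprime (p ^ (k + e)) t by rewrite coprimeXl.
  have n_p : n %% p ^ (k + e) = zpv x (k + e).
    by rewrite chinese_modl // zpv_mod.
  exists n; split; last first.
    rewrite -(zpv_le_mod x (leq_addr e k)) -n_p modn_dvdm //.
    by rewrite dvdn_exp2l // leq_addr.
  suff : n == b %[mod t * p ^ e] by rewrite -eT (modn_small (ltn_ord b)).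
  rewrite chinese_remainder; last by rewrite coprime_sym coprimeXl.
  rewrite chinese_modr // eqxx /=.
  have -> : n %% p ^ e = zpv x e.
    by rewrite -(zpv_le_mod x (leq_addl k e)) -n_p modn_dvdm // dvdn_exp2l // leq_addl.
  by rewrite exy affineE zpvD zpv_expM add0n zpvn !modn_mod.
- move=> b x eps eps0; have [N hN] := expp_inv_lt p1 eps0.
  (* [zp_shift e] loses e digits of precision. *)
  exists (N + e) => y exy; apply: le_lt_trans (hN N (leqnn N)).
  by apply: abs_le; apply: F_cont; rewrite !zpv_shift exy.
have [C [D [C0 D0 D1 CD]]] := exp_decay R p1 T0.
exists C, D; split=> // b n /eqP e_b.
have : n = b + T * (n %/ T) by rewrite {1}(divn_eq n T) e_b addnC mulnC.
move: (n %/ T) => m {e_b} ->; apply: le_trans (CD b m (ltn_ord b)).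
(* The quotient of b + T m by q is that of b plus t m, the point at which [F b] matches s(b + T m)
   modulo p^m. *)
apply: abs_le; rewrite (FcoP b).2 -/(F b); congr (zpv (F b _) _).
move: (nat_of_ord b) => c; have ltc : c %% p ^ e < p ^ e by rewrite ltn_mod.
rewrite zp_of_natE -[LHS](zp_shift_affine _ ltc); congr (zp_shift _ _).
rewrite -natrX -natrM -natrD; congr (_%:R)%R.
by rewrite {3}(divn_eq c (p ^ e)) eT; ring.
Qed.
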